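(* Let $q$ be a prime power, $W$ a $t$-dimensional $\mathbb{F}_q$-vector space, and let $\mathcal{C}\subseteq\mathrm{Hom}_{\mathbb{F}_q}(\mathbb{F}_{q^n},W)$ be an $\mathbb{F}_q$-linear MRD code with parameters $(t,n,q;n-\iota)$ such that $t\geq n$ and $|R(\mathcal{C})|=q^n$. Let $r=\dim_{R(\mathcal{C})}(\mathcal{C})$. Then the following hold. (1) $\iota+1$ divides $rn$ and $t=\frac{rn}{\iota+1}$. (2) $\mathcal{C}$ is equivalent to an $\mathbb{F}_q$-linear MRD code $\mathcal{C}'\subseteq\mathrm{Hom}_{\mathbb{F}_q}(\mathbb{F}_{q^n},W)$ such that $R(\mathcal{C}')=\mathcal{F}_n$. (3) The set $U=\{f\in\mathcal{C}' : f(1)=0\}\subseteq\mathcal{C}'$ is a $\frac{\iota rn}{\iota+1}$-dimensional $\mathcal{F}_{n,q}$-subspace of $\mathcal{C}'$, and satisfies $$\max\left\{\dim_{\mathcal{F}_{n,q}}\left(U\cap\langle f\rangle_{\mathcal{F}_n}\right) : f\in\mathcal{C}'\right\}=\iota,$$ where $\langle f\rangle_{\mathcal{F}_n}=\{f\circ\omega_\alpha : \alpha\in\mathbb{F}_{q^n}\}$. (4) $\mathcal{C}'$ is equal to $\mathcal{C}_{U,G}$, where $G:\mathcal{C}'\to W$, $f\mapsto f(1)$.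
   Context: **Rank metric codes.** For $\mathbb{F}_q$-spaces $W_1,W_2$ of dimensions $n$ and $m$, an $\mathbb{F}_q$-linear rank metric code with parameters $(m,n,q;d)$ is an $\mathbb{F}_q$-subspace $\mathcal{C}$ of $\mathrm{Hom}_{\mathbb{F}_q}(W_1,W_2)$ whose minimum distance (minimum rank of a nonzero element) is $d$. It is MRD if $|\mathcal{C}|=q^{\max\{m,n\}(\min\{m,n\}-d+1)}$. Its right idealiser is $R(\mathcal{C})=\{Z\in\mathrm{End}_{\mathbb{F}_q}(W_1): f\circ Z\in\mathcal{C}\ \forall f\in\mathcal{C}\}$ (for an $\mathbb{F}_q$-linear code with $m\ge n$ and $d>1$ it is known to be a finite field of order at most $q^n$); $\mathcal{C}$ is a right $R(\mathcal{C})$-module under composition, and $\dim_{R(\mathcal{C})}(\mathcal{C})$ is its dimension as a right vector space over the field $R(\mathcal{C})$. Identifying maps with matrices in $\mathbb{F}_q^{m\times n}$ via fixed bases, two codes $\mathcal{C},\mathcal{C}'$ are equivalent if $\mathcal{C}'=\{XC^\sigma Y+Z:C\in\mathcal{C}\}$ for some $X\in\mathrm{GL}(m,q)$, $Y\in\mathrm{GL}(n,q)$, $Z\in\mathbb{F}_q^{m\times n}$, $\sigma\in\mathrm{Aut}(\mathbb{F}_q)$. **Notation.** $\omega_\alpha:\mathbb{F}_{q^n}\to\mathbb{F}_{q^n}$, $x\mapsto\alpha x$; $\mathcal{F}_n=\{\omega_\alpha:\alpha\in\mathbb{F}_{q^n}\}\cong\mathbb{F}_{q^n}$; $\mathcal{F}_{n,q}=\{\omega_\alpha:\alpha\in\mathbb{F}_q\}\cong\mathbb{F}_q$.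 If $R(\mathcal{C}')=\mathcal{F}_n$, then $\mathcal{C}'$ is regarded as an $\mathbb{F}_{q^n}$-vector space with $\alpha\in\mathbb{F}_{q^n}$ acting by $f\mapsto f\circ\omega_\alpha$. **Codes $\mathcal{C}_{U,G}$.** For an $r$-dimensional $\mathbb{F}_{q^n}$-space $V$, an $\mathbb{F}_q$-subspace $U$ of $V$ of $\mathbb{F}_q$-dimension $k$, an $(rn-k)$-dimensional $\mathbb{F}_q$-space $W$ and an $\mathbb{F}_q$-linear map $G:V\to W$ with $\ker G=U$, put $\mathcal{C}_{U,G}=\{G\circ\tau_{\mathbf v}:\mathbf v\in V\}$, where $\tau_{\mathbf v}:\mathbb{F}_{q^n}\to V$, $\lambda\mapsto\lambda\mathbf v$. In (4) this is applied with $V=\mathcal{C}'$, so $\tau_f(\alpha)=f\circ\omega_\alpha$. *)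

(* Defs.v *)
From HB Require Import structures.
From mathcomp Require Import all_boot all_order all_algebra all_field.

Set Implicit Arguments.
Unset Strict Implicit.
Unset Printing Implicit Defensive.

Import GRing.Theory.
Local Open Scope ring_scope.

Section ModuleDimension.

(* A set [K] of scalars (in practice a field) acts on a subspace [V] on the
   right by [act]. Everything is finite, so bases are boolean predicates. *)
Variables (S E : finZmodType) (act : E -> S -> E).
Variables (K : {set S}) (V : {set E}).

Definition act_spans (B : {set E}) :=
  [forall v in V, exists c : {ffun E -> S},
     [forall b in B, c b \in K] && (v == \sum_(b in B) act b (c b))].

Definition act_free (B : {set E}) :=
  [forall c : {ffun E -> S},
     [forall b in B, c b \in K] && (\sum_(b in B) act b (c b) == 0)
       ==> [forall b in B, c b == 0]].

Definition act_basis (B : {set E}) :=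
  [&& B \subset V, act_spans B & act_free B].

(* The value 0 is junk when there is no basis; there is one as soon as [K] is
   a field acting on [V], and all bases then have the same size. *)
Definition act_dim : nat :=
  if [pick B | act_basis B] is Some B then #|B| else 0%N.

End ModuleDimension.

Section RankMetricCodes.

Variables (F : finFieldType) (W1 W2 : vectType F).
Implicit Types C : {vspace 'Hom(W1, W2)}.

Definition code_set C : {set finvect_type 'Hom(W1, W2)} :=
  [set f : finvect_type 'Hom(W1, W2) | f \in C].

Definition min_distance C (d : nat) : Prop :=
  (exists f, [/\ f \in C, f != 0 & \dim (limg f) = d]) /\
  (forall f, f \in C -> f != 0 -> (d <= \dim (limg f))%N).

Definition rank_code (m n d : nat) C : Prop :=
  [/\ \dim {:W2} = m, \dim {:W1} = n & min_distance C d].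

Definition MRD_code (m n d : nat) C : Prop :=
  rank_code m n d C /\
  #|code_set C| = (#|F| ^ (maxn m n * (minn m n - d + 1)))%N.

Definition right_idealiser C : {set finvect_type 'End(W1)} :=
  [set Z : finvect_type 'End(W1) |
           [forall f : finvect_type 'Hom(W1, W2),
              (f \in C) ==> ((f \o Z)%VF \in C)]].

Definition right_dim C : nat :=
  act_dim
    (fun (f : finvect_type 'Hom(W1, W2)) (Z : finvect_type 'End(W1)) =>
       (f \o Z)%VF)
    (right_idealiser C) (code_set C).

(* [passmx.mxof] acts on row vectors; codes use matrices acting on columns. *)
Definition code_mx (e1 : (\dim {:W1}).-tuple W1) (e2 : (\dim {:W2}).-tuple W2)
    (f : 'Hom(W1, W2)) : 'M[F]_(\dim {:W2}, \dim {:W1}) :=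
  (passmx.mxof e1 e2 f)^T.

Definition equivalent_codes
    (e1 : (\dim {:W1}).-tuple W1) (e2 : (\dim {:W2}).-tuple W2) C C' : Prop :=
  exists (X : 'M[F]_(\dim {:W2})) (Y : 'M[F]_(\dim {:W1}))
         (Z : 'M[F]_(\dim {:W2}, \dim {:W1})) (sigma : {rmorphism F -> F}),
    [/\ X \in unitmx, Y \in unitmx, bijective sigma
      & forall g, g \in C' <->
          exists2 f, f \in C &
            code_mx e1 e2 g
              = X *m map_mx sigma (code_mx e1 e2 f) *m Y + Z].

End RankMetricCodes.

Section LinearSetCodes.

Variables (F : finFieldType) (L : fieldExtType F).

(* An [L]-vector space structure on an [F]-space extending its [F]-structure;
   [a%:A] is the image of [a : F] in [L]. *)
Record extension_action (V : vectType F) := ExtensionAction {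
  ext_act :> L -> V -> V;
  ext_act1 : forall v, ext_act 1 v = v;
  ext_actM : forall a b v, ext_act (a * b) v = ext_act a (ext_act b v);
  ext_actDl : forall a b v, ext_act (a + b) v = ext_act a v + ext_act b v;
  ext_actDr : forall a v w, ext_act a (v + w) = ext_act a v + ext_act a w;
  ext_actF : forall (a : F) v, ext_act a%:A v = a *: v
}.

Section CodeUG.

Variables (V W : vectType F) (A : extension_action V).

Definition tau_fun (v : V) (a : L) : V := A a v.

Fact tau_is_linear v : linear (tau_fun v).
Proof.
by move=> k a b; rewrite /tau_fun ext_actDl -mulr_algl ext_actM ext_actF.
Qed.
HB.instance Definition _ v :=
  GRing.isSemilinear.Build F L V _ (tau_fun v)
    (GRing.semilinear_linear (tau_is_linear v)).

Definition tau (v : V) : 'Hom(L, V) := linfun (tau_fun v).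

Lemma tauE v a : tau v a = A a v.
Proof. by rewrite lfunE. Qed.

Definition ext_dim : nat :=
  act_dim (fun (v : finvect_type V) (a : finvect_type L) => A a v)
    [set: finvect_type L] [set: finvect_type V].

(* [limg (tau v)] is the [L]-line spanned by [v]. *)
Lemma mem_limg_tau v w :
  reflect (exists a, w = A a v) (w \in limg (tau v)).
Proof.
apply: (iffP memv_imgP) => [[a _ ->]|[a ->]]; exists a; rewrite ?tauE //.
exact: memvf.
Qed.

Definition CUG_data (r n : nat) (U : {vspace V}) (G : 'Hom(V, W)) : Prop :=
  [/\ \dim {:L} = n, ext_dim = r,
      (\dim {:W} + \dim U = r * n)%N & lker G = U].

Definition CUG (G : 'Hom(V, W)) : {set finvect_type 'Hom(L, W)} :=
  [set ((G \o tau v)%VF : finvect_type 'Hom(L, W)) | v : finvect_type V].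

End CodeUG.

Section CodeAsExtensionSpace.

Variable W : vectType F.

(* [amull a] is the map x |-> a * x. *)
Definition mult_maps : {set finvect_type 'End(L)} :=
  [set (amull (a : L) : finvect_type 'End(L)) | a : finvect_type L].

Variables (C : {vspace 'Hom(L, W)}) (hC : right_idealiser C = mult_maps).

Lemma precomp_mem (f : subvs_of C) a : (vsval f \o amull a)%VF \in C.
Proof.
have : (amull a : finvect_type _) \in right_idealiser C.
  by rewrite hC; apply/imsetP; exists a.
by rewrite inE => /forallP /(_ (vsval f)) /implyP; apply; apply: subvsP.
Qed.

Definition precomp (a : L) (f : subvs_of C) : subvs_of C :=
  Subvs (precomp_mem f a).

Fact precomp1 f : precomp 1 f = f.
Proof. by apply: val_inj; rewrite /= amull1 comp_lfun1r. Qed.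

Fact precompM a b f : precomp (a * b) f = precomp a (precomp b f).
Proof.
apply: val_inj; apply/lfunP => x /=.
by rewrite !(comp_lfunE, lfunE) /= mulrA [b * a]mulrC.
Qed.

Fact precompDl a b f : precomp (a + b) f = precomp a f + precomp b f.
Proof.
by apply: val_inj; rewrite /= linearD /= comp_lfunDr.
Qed.

Fact precompDr a f g : precomp a (f + g) = precomp a f + precomp a g.
Proof. by apply: val_inj; rewrite /= comp_lfunDl. Qed.

(* Scalars from the maps x |-> k * x with [k : F] act as the [F]-structure of
   [subvs_of C], so [\dim] is the dimension over the field of these maps. *)
Fact precompF (k : F) f : precomp k%:A f = k *: f.
Proof.
by apply: val_inj; rewrite /= linearZ /= amull1 -comp_lfunZr comp_lfun1r.
Qed.

Definition code_action : extension_action (subvs_of C) :=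
  ExtensionAction precomp1 precompM precompDl precompDr precompF.

End CodeAsExtensionSpace.

Section EvalAtOne.

Variables (W : vectType F) (C : {vspace 'Hom(L, W)}).

Definition eval_one_fun (f : subvs_of C) : W := vsval f 1.

Fact eval_one_is_linear : linear eval_one_fun.
Proof. by move=> k f g; rewrite /eval_one_fun linearP lfunE /= lfunE. Qed.
HB.instance Definition _ :=
  GRing.isSemilinear.Build F (subvs_of C) W _ eval_one_fun
    (GRing.semilinear_linear eval_one_is_linear).

Definition eval_one : 'Hom(subvs_of C, W) := linfun eval_one_fun.

Lemma eval_oneE f : eval_one f = vsval f 1.
Proof. by rewrite lfunE. Qed.

End EvalAtOne.

End LinearSetCodes.

(* Main.v *)
From HB Require Import structures.
Require Import Defs.
From mathcomp Require Import all_boot all_order all_fingroup all_algebra.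
From mathcomp Require Import all_solvable all_field zify.

Set Implicit Arguments.
Unset Strict Implicit.
Unset Printing Implicit Defensive.

Import GRing.Theory.
Local Open Scope ring_scope.

(** The idea is to read everything off one property of MRD codes. A nonzero
map of the code [C] has a kernel of dimension at most [iota], and
[\dim C = (iota + 1) * t]; hence restriction to a subspace [K] of dimension
[iota + 1] maps [C] injectively, so bijectively, to [Hom(K, W)], and every
linear map agrees on [K] with a unique map of the code ([interpolation]).

This first shows that nonzero elements of the right idealiser [R] are
injective ([MRD_idealiser_inj]). Let [Z] in [R] be nonzero with a kernel. If
its image has dimension more than [iota], then [f |-> f \o Z] is injective on
[C], so [C] consists of maps that vanish on the kernel of [Z], against
interpolation at one point. If the image is smaller, a map of [C] that
interpolates a map of rank one on it gives a composite of rank one in [C], so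
the minimum distance is one and [C] is the whole of [Hom]. Its idealiser then
has [q ^ (n ^ 2)] elements, so [n = 1], and [Z] cannot be nonzero with a kernel.

Hence [R] is a finite division ring with [q ^ n] elements, so a field by
Wedderburn's theorem, and [C] is a vector space over it. Counting elements,
[|C| = |R| ^ r], that is [r * n = t * (iota + 1)] ([right_dim_MRD]).

To normalise the idealiser, observe that a finite division algebra of the same
dimension as [L] is isomorphic to [L] ([finite_division_alg_hom]): [L] is
generated by one element, whose minimal polynomial divides ['X^(q ^ n) - 'X]
and therefore has a root in the algebra. An isomorphism [psi] from [L] to [R]
gives the bijection [g : a |-> psi a 1] of [L], and [g] conjugates
multiplication by [a] to [psi a] ([division_subalgebra_conj]). Thus [g]
conjugates the algebra of multiplications to [R], and the idealiser of
[C \o g] consists of the multiplications.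

When [R] is the algebra of multiplications, [f \o amull a] takes at [1] the
value [f a]. So evaluation at [1] recovers the whole code, and an intersection
of its kernel [U] with the line of [f] is a copy of the kernel of [f]: the
largest has dimension [n] minus the minimum distance, which is [iota].
Interpolation at [1] makes the evaluation surjective, which gives the dimension
of [U]. *)

(** * Subspaces over a finite field *)

Lemma card_finvect_sub (F : finFieldType) (V : vectType F) (U : {vspace V}) :
  #|[set x : finvect_type V | x \in U]| = (#|F| ^ \dim U)%N.
Proof.
(* [card_vspace] sees the space as a vector structure on its finite carrier. *)
case: V U => T classT U; rewrite cardsE.
exact: (@card_vspace F (finvect_type (Vector.Pack classT)) classT U).
Qed.

Lemma card_finvect (F : finFieldType) (V : vectType F) :
  #|finvect_type V| = (#|F| ^ \dim {:V})%N.
Proof.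
rewrite -card_finvect_sub -cardsT; apply: eq_card => x.
by rewrite !inE memvf.
Qed.

Lemma linear_set_vspace (F : finFieldType) (V : vectType F)
    (S : {set finvect_type V}) :
  (0 : V) \in S ->
  (forall (c : F) (u v : V), u \in S -> v \in S -> (c *: u + v : V) \in S) ->
  exists U : {vspace V}, forall v : V, (v \in U) = (v \in S).
Proof.
move=> S0 Slin; pose X : seq V := enum S.
have mem_X (v : V) : (v \in X) = (v \in S).
  by have := mem_enum S (v : finvect_type V).
exists <<X>>%VS => v; apply/idP/idP => [Xv | Sv]; last first.
  by rewrite memv_span ?mem_X.
rewrite (coord_span (X := in_tuple X) Xv).
elim/big_rec: _ => // i u _ Su; apply: Slin => //.
by rewrite -mem_X mem_nth.
Qed.

Lemma dim_limg (F : fieldType) (V W : vectType F) (f : 'Hom(V, W)) :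
  (\dim (lker f) + \dim (limg f))%N = \dim {:V}.
Proof. by have := limg_ker_dim f fullv; rewrite capfv. Qed.

Lemma exists_rank1_hom (F : fieldType) (V W : vectType F) (z : V) (w : W) :
  z != 0 ->
  exists2 h : 'Hom(V, W), h z = w & (limg h <= <[w]>)%VS.
Proof.
move=> nz_z; pose h_fun x := coord [tuple z] 0 (projv <[z]> x) *: w.
have h_lin : linear h_fun.
  by move=> c x y; rewrite /h_fun !linearP /= scalerDl scalerA.
pose h1 := GRing.isSemilinear.Build F V W _ h_fun
  (GRing.semilinear_linear h_lin).
pose h : {linear V -> W} := HB.pack h_fun h1.
exists (linfun h).
  have free_z : free [tuple z] by rewrite seq1_free.
  rewrite lfunE /= /h_fun projv_id ?memv_line //.
  by have := coord_free 0 0 free_z => /= ->; rewrite scale1r.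
apply/subvP => _ /memv_imgP[x _ ->]; rewrite lfunE /=.
by rewrite memvZ ?memv_line.
Qed.

Lemma dim_hom (F : fieldType) (U V : vectType F) :
  \dim {:'Hom(U, V)} = (\dim {:U} * \dim {:V})%N.
Proof. by rewrite !dimvf. Qed.

Lemma subv_extend (F : fieldType) (V : vectType F) (K : {vspace V}) k :
  (\dim K <= k <= \dim {:V})%N ->
  exists2 K' : {vspace V}, (K <= K')%VS & \dim K' = k.
Proof.
move=> /andP[Kk kV]; pose X := vbasis K ++ vbasis K^C.
have freeX : free X.
  rewrite cat_free !(basis_free (vbasisP _)) /=.
  by rewrite !(span_basis (vbasisP _)); apply/directv_addP/capv_compl.
have sizeX : size X = \dim {:V}.
  by rewrite size_cat !size_tuple dimv_compl subnKC // dimvS ?subvf.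
exists <<take k X>>%VS; last first.
  have: free (take k X).
    by move: freeX; rewrite -{1}(cat_take_drop k X) => /catl_free.
  by move/eqP; rewrite size_takel ?sizeX.
rewrite -{1}(span_basis (vbasisP K)); apply: sub_span => x Kx.
by rewrite take_cat size_tuple ltnNge Kk /= mem_cat Kx.
Qed.

(** * Finite division algebras *)

(** The multiplicative group of a finite field is cyclic, and a generator of
it generates the algebra. *)
Lemma finite_ext_horner_surj (F : finFieldType) (L : fieldExtType F) :
  exists x : L, forall a : L, exists p : {poly F}, a = horner_alg x p.
Proof.
pose fL : finFieldType := finvect_type L.
have /cyclicP[u defu] : cyclic [set: {unit fL}].
  by apply: field_unit_group_cyclic.
exists (FinRing.uval u : fL) => a.
have [->|a0] := eqVneq a 0; first by exists 0; rewrite rmorph0.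
have : (finField_unit (a0 : (a : fL) != 0)) \in <[u]>%g by rewrite -defu inE.
case/cycleP=> i /(congr1 val) /= ai.
exists 'X^i; rewrite rmorphXn /= horner_algX.
by rewrite [LHS]ai FinRing.val_unitX.
Qed.

(** The minimal polynomial of [x] over [F] divides ['X^#|L| - 'X], which is a
product of linear factors over any field with as many elements as [L]. *)
Lemma root_of_annihilator (F K : finFieldType) (i : {rmorphism F -> K})
    (L : fieldExtType F) (x : L) :
  #|K| = (#|F| ^ \dim {:L})%N ->
  exists y : K,
    forall p : {poly F}, horner_alg x p = 0 -> (map_poly i p).[y] = 0.
Proof.
move=> cardK; pose fL : finFieldType := finvect_type L.
have cardL : #|fL| = #|K| by rewrite cardK; exact: card_finvect.
have /polyOver1P[m Dm] : minPoly 1 x \is a polyOver 1%VS by exact: minPolyOver.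
have m_dvd p : horner_alg x p = 0 -> m %| p.
  move=> /eqP px; rewrite -(dvdp_map (in_alg L)) -Dm minPoly_dvdp //.
  by apply/polyOver1P; exists p.
have m_gt1 : size (map_poly i m) != 1.
  rewrite size_map_poly -(size_map_poly (in_alg L)) -Dm size_minPoly.
  by rewrite eqSS -lt0n.
have : map_poly i m %| 'X^#|K| - 'X.
  have -> : 'X^#|K| - 'X = map_poly i ('X^#|K| - 'X).
    by rewrite rmorphB /= map_polyXn map_polyX.
  rewrite dvdp_map; apply: m_dvd.
  rewrite rmorphB rmorphXn /= horner_algX -cardL.
  by rewrite [X in X - _](expf_card (x : fL)) subrr.
rewrite finField_genPoly -big_enum /= => /dvdp_prod_XsubC[b mb].
have [y] : exists y, y \in mask b (enum K).
  case: (mask b _) mb => [|y s]; last by exists y; rewrite inE eqxx.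
  by rewrite big_nil -size_poly_eq1 (negPf m_gt1).
rewrite -root_prod_XsubC -(eqp_root mb) => /rootP my.
exists y => p /m_dvd; rewrite -(dvdp_map i) => /dvdpP[q ->].
by rewrite hornerM my mulr0.
Qed.

(** Wedderburn's little theorem, as an isomorphism with a commutative field
rather than as commutativity of [D], so that polynomials over the field can be
factored. *)
Lemma finite_division_alg_field (F : finFieldType) (D : falgType F) :
  GRing.integral_domain_axiom D ->
  exists (K : finFieldType) (h : {rmorphism K -> D}), bijective h.
Proof.
move=> domD; pose K := @FinDomainFieldType (finvect_type D) domD.
pose h (c : K) : D := c.
have hA : zmod_morphism h by [].
have hM : monoid_morphism h by [].
pose h1 := GRing.isZmodMorphism.Build K D h hA.
pose h2 := GRing.isMonoidMorphism.Build K D h hM.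
exists K, (HB.pack h h1 h2 : {rmorphism K -> D}).
by exists id.
Qed.

(** With [x] a generator of [L] and [y] a root in [D] of its minimal
polynomial, the map sends [p.[x]] to [p.[y]]; it is well defined because every
polynomial over [F] that kills [x] kills [y]. *)
Lemma finite_division_alg_hom (F : finFieldType) (L : fieldExtType F)
    (D : falgType F) :
  GRing.integral_domain_axiom D -> \dim {:D} = \dim {:L} ->
  exists2 psi : 'Hom(L, D), psi 1 = 1 & {morph psi : a b / a * b}.
Proof.
move=> /finite_division_alg_field[K [h [g hK gK]]] dimD.
pose i (c : F) := g c%:A.
have iA : zmod_morphism i.
  move=> a b; apply: (can_inj hK); rewrite rmorphB !gK.
  exact: (rmorphB (in_alg D)).
have iM : monoid_morphism i.
  by split=> [|a b]; apply: (can_inj hK); rewrite ?(rmorph1 h) ?(rmorphM h) !gK;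
     [apply: (rmorph1 (in_alg D)) | apply: (rmorphM (in_alg D))].
pose i1 := GRing.isZmodMorphism.Build F K i iA.
pose i2 := GRing.isMonoidMorphism.Build F K i iM.
pose iR : {rmorphism F -> K} := HB.pack i i1 i2.
have cardK : #|K| = (#|F| ^ \dim {:L})%N.
  rewrite -dimD -card_finvect.
  by apply: (bij_eq_card (f := h : K -> finvect_type D)); exists g.
have [x gen_x] := finite_ext_horner_surj L.
have [z ann_z] := root_of_annihilator iR x cardK.
pose y := h z.
have ann_y p : horner_alg x p = 0 -> horner_alg y p = 0.
  move/ann_z/(congr1 h); rewrite rmorph0 => <-.
  rewrite -horner_map -map_poly_comp; congr _.[_].
  by apply: eq_map_poly => c /=; rewrite gK.
have [rep repE] :
    exists rep : L -> {poly F}, forall a, a = horner_alg x (rep a).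
  have ex_rep a : exists p, a == horner_alg x p.
    by have [p ->] := gen_x a; exists p.
  by exists (fun a => xchoose (ex_rep a)) => a; apply/eqP/(xchooseP (ex_rep a)).
have [psi psiE] :
    exists psi : L -> D, forall p, psi (horner_alg x p) = horner_alg y p.
  exists (fun a => horner_alg y (rep a)) => p.
  apply/eqP; rewrite -subr_eq0 -rmorphB; apply/eqP/ann_y.
  by rewrite rmorphB /= -repE subrr.
have hornZ (A : algType F) (u : A) c p :
    horner_alg u (c *: p) = c *: horner_alg u p.
  by rewrite linearZ /= mulr_algl.
have psi_lin : linear psi.
  by move=> c a b; rewrite (repE a) (repE b) -hornZ -rmorphD !psiE rmorphD
    /= hornZ.
pose psi1 := GRing.isSemilinear.Build F L D _ psi
  (GRing.semilinear_linear psi_lin).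
pose psiL : {linear L -> D} := HB.pack psi psi1.
exists (linfun psiL) => [|a b]; rewrite !lfunE /=.
  by rewrite -(rmorph1 (horner_alg x)) psiE rmorph1.
by rewrite (repE a) (repE b) -rmorphM !psiE rmorphM.
Qed.

Section DivisionSubalgebra.

Import FalgLfun.

(** [L] is a vector space of dimension one over [R], with basis [1]: an
isomorphism [psi] from [L] to [R] makes [g : a |-> psi a 1] bijective, and
[g (a * b) = psi a (g b)] because [psi] is multiplicative and [L] is
commutative. *)
Lemma division_subalgebra_conj (F : finFieldType) (L : fieldExtType F)
    (R : {vspace 'End(L)}) :
  \1%VF \in R -> (forall f g, f \in R -> g \in R -> (f \o g)%VF \in R) ->
  (forall f, f \in R -> f != 0 -> lker f == 0%VS) -> \dim R = \dim {:L} ->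
  exists2 g : 'End(L), lker g == 0%VS &
     forall a, exists2 f, f \in R & (g \o amull a = f \o g)%VF.
Proof.
move=> R1 RM Rinj dimR.
have R_aspace : is_aspace R.
  apply/andP; split; first exact: (has_algid1 R1).
  by apply/prodvP => f g Rf Rg; rewrite -lfun_compE RM.
pose A : {aspace 'End(L)} := ASpace R_aspace.
(* Products in the algebra of endomorphisms are composed left to right. *)
have valM (f g : subvs_of A) : vsval (f * g) = (vsval g \o vsval f)%VF.
  by rewrite lfun_compE.
have val1 : vsval (1 : subvs_of A) = \1%VF.
  by apply/eqP; rewrite [_ == _](algid_eq1 A); exact: R1.
have inj_val (f : subvs_of A) : f != 0 -> lker (vsval f) == 0%VS.
  move=> f0; apply: (Rinj _ (subvsP f)); apply: contra_neq f0 => f0.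
  exact: val_inj.
have domA : GRing.integral_domain_axiom (subvs_of A).
  move=> f g fg0; have [_ | g0] := eqVneq g 0; rewrite ?orbT ?orbF //.
  have /lker0P injg := inj_val g g0.
  apply/eqP/val_inj/lfunP=> x; apply: injg.
  by rewrite -comp_lfunE -valM fg0 /= !zero_lfunE linear0.
have dimA : \dim {:subvs_of A} = \dim {:L} by rewrite dimvf.
have [psi psi1 psiM] := finite_division_alg_hom domA dimA.
pose g_fun a := vsval (psi a) 1.
have g_lin : linear g_fun.
  by move=> c a b; rewrite /g_fun !linearP /= !lfunE /= !lfunE.
pose g1 := GRing.isSemilinear.Build F L L _ g_fun
  (GRing.semilinear_linear g_lin).
pose gL : {linear L -> L} := HB.pack g_fun g1.
have gE a : linfun gL a = vsval (psi a) 1 by rewrite lfunE.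
exists (linfun gL) => [|a]; last first.
  exists (vsval (psi a)); first exact: subvsP.
  apply/lfunP => b; rewrite !comp_lfunE !gE [amull a b]lfunE /=.
  by rewrite mulrC psiM valM comp_lfunE.
apply/lker0P/raddf_inj => a /=; rewrite gE => psia1.
apply/eqP; apply: contraT => a0.
have psia0 : psi a != 0.
  apply: contraTneq (oner_neq0 (subvs_of A)) => pa0.
  by rewrite -psi1 -(mulVf a0) psiM pa0 mulr0 eqxx.
have /lker0P inj_psia := inj_val _ psia0.
have /eqP := inj_psia 1 0 (etrans psia1 (esym (linear0 _))).
by rewrite oner_eq0.
Qed.

End DivisionSubalgebra.

(** * Dimension over a finite division ring *)

Section ActDim.

(* The product [mul] of scalars is composition in the case of idealisers, and
the reversed product of [L] in the case of an action written on the left. *)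
Variables (S E : finZmodType) (act : E -> S -> E) (mul : S -> S -> S) (one : S).
Variables (K : {set S}) (V : {set E}).

Hypotheses (actDl : forall u v a, act (u + v) a = act u a + act v a)
  (actDr : forall v a b, act v (a + b) = act v a + act v b)
  (actM : forall v a b, act (act v a) b = act v (mul a b))
  (act1 : forall v, act v one = v).
Hypotheses (K1 : one \in K) (KB : forall a b, a \in K -> b \in K -> a - b \in K)
  (KM : forall a b, a \in K -> b \in K -> mul a b \in K)
  (KV : forall a, a \in K -> a != 0 -> exists2 b, b \in K & mul a b = one).
Hypotheses (V0 : 0 \in V) (VD : forall u v, u \in V -> v \in V -> u + v \in V)
  (VK : forall v a, v \in V -> a \in K -> act v a \in V).

Let act0l a : act 0 a = 0.
Proof. by apply: (addrI (act 0 a)); rewrite -actDl !addr0. Qed.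

Let act0r v : act v 0 = 0.
Proof. by apply: (addrI (act v 0)); rewrite -actDr !addr0. Qed.

Let actBr v a b : act v (a - b) = act v a - act v b.
Proof. by apply/eqP; rewrite eq_sym subr_eq -actDr subrK. Qed.

Let K0 : 0 \in K.
Proof. by rewrite -(subrr one) KB. Qed.

Let KN a : a \in K -> - a \in K.
Proof. by move=> Ka; rewrite -(sub0r a) KB. Qed.

Lemma act_freeP (B : {set E}) :
  reflect (forall c : {ffun E -> S}, {in B, forall b, c b \in K} ->
             \sum_(b in B) act b (c b) = 0 -> {in B, forall b, c b = 0})
          (act_free act K B).
Proof.
apply: (iffP forallP) => [freeB c cK c0 b Bb | freeB c].
  have /implyP := freeB c; rewrite c0 eqxx andbT => /(_ _)/forall_inP freec.
  by apply/eqP/freec=> //; apply/forall_inP.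
apply/implyP => /andP[/forall_inP cK /eqP c0].
by apply/forall_inP => b Bb; apply/eqP/freeB.
Qed.

(** A maximal free subset spans: a relation between [v] and the elements of [B]
has a coefficient at [v] that is invertible. *)
Lemma act_basis_exists : exists B, act_basis act K V B.
Proof.
pose P (B : {set E}) := (B \subset V) && act_free act K B.
have P0 : P set0.
  by rewrite /P sub0set; apply/act_freeP => c _ _ b; rewrite inE.
have [B /maxsetP[/andP[BV freeB] maxB] _] := maxset_exists P0.
exists B; rewrite /act_basis BV freeB andbT /=.
apply/forall_inP => v Vv; apply/existsP.
have [Bv | notBv] := boolP (v \in B).
  exists [ffun b => if b == v then one else 0]; apply/andP; split.
    by apply/forall_inP => b _; rewrite ffunE; case: ifP.
  rewrite (big_setD1 v) //= ffunE eqxx act1 big1 ?addr0 // => b.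
  by rewrite !inE => /andP[/negPf nbv _]; rewrite ffunE nbv act0r.
have notfree : ~~ act_free act K (v |: B).
  apply: contra notBv => free_vB; rewrite -(maxB (v |: B)) ?setU11 ?subsetUr //.
  by rewrite /P subUset sub1set Vv BV.
move: notfree; rewrite negb_forall => /existsP[c]; rewrite negb_imply.
case/andP=> /andP[/forall_inP cK]; rewrite big_setU1 //= => /eqP c0 nz_c.
have nz_cv : c v != 0.
  apply: contra nz_c => /eqP cv0; apply/forall_inP => b /setU1P[-> | Bb].
    by rewrite cv0.
  apply/eqP; move: b Bb; apply: (act_freeP _ freeB) => [b Bb|].
    by rewrite cK // setU1r.
  by move: c0; rewrite cv0 act0r add0r.
have [d Kd cvd] := KV (cK v (setU11 _ _)) nz_cv.
exists [ffun b => - mul (c b) d]; apply/andP; split.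
  by apply/forall_inP => b Bb; rewrite ffunE KN // KM // cK // setU1r.
have /eqP := congr1 (act^~ d) c0.
rewrite actDl actM cvd act1 act0l addr_eq0 => /eqP->.
rewrite (big_morph (act^~ d) (fun u w => actDl u w d) (act0l d)) -sumrN.
apply/eqP/eq_bigr => b _.
by rewrite ffunE actM -[- mul _ _]sub0r actBr act0r sub0r.
Qed.

(** The families of scalars supported by a basis are in bijection with [V]. *)
Lemma card_act_basis B : act_basis act K V B -> #|V| = (#|K| ^ #|B|)%N.
Proof.
case/and3P=> /subsetP BV /forall_inP spanB /act_freeP freeB.
pose comb (c : {ffun E -> S}) := \sum_(b in B) act b (c b).
have coefP (c : {ffun E -> S}) : c \in pffun_on 0 B K ->
    {in B, forall b, c b \in K} /\ forall b, b \notin B -> c b = 0.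
  case/pffun_onP=> /subsetP supp imK; split=> [b Bb | b notBb].
    by apply: imK; apply/imageP; exists b.
  by apply/eqP; apply: contraNT notBb => /supp.
rewrite -(card_pffun_on 0) -(card_in_imset (f := comb) (D := pffun_on 0 B K)).
  apply: eq_card => v.
  apply/idP/imsetP => [Vv | [c /coefP[cK _] ->]]; last first.
    by apply: (big_ind (fun u => u \in V)) => // b Bb; rewrite VK ?BV ?cK.
  have /existsP[c /andP[/forall_inP cK /eqP->]] := spanB v Vv.
  exists [ffun b => if b \in B then c b else 0].
    apply/pffun_onP; split.
      by apply/subsetP => b; rewrite inE ffunE; case: ifP; rewrite ?eqxx.
    by move=> _ /imageP[b Bb ->]; rewrite ffunE Bb cK.
  by apply: eq_bigr => b Bb; rewrite ffunE Bb.
move=> c1 c2 /coefP[c1K c1out] /coefP[c2K c2out] /eqP.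
rewrite -subr_eq0 /comb -sumrB => /eqP sum0.
apply/ffunP => b; have [Bb | notBb] := boolP (b \in B); last first.
  by rewrite c1out ?c2out.
apply/eqP; rewrite -subr_eq0.
have := freeB [ffun b => c1 b - c2 b] _ _ b Bb; rewrite ffunE => ->//.
  by move=> b' Bb'; rewrite ffunE KB ?c1K ?c2K.
by rewrite -[RHS]sum0; apply: eq_bigr => b' _; rewrite ffunE actBr.
Qed.

Lemma card_act_dim : #|V| = (#|K| ^ act_dim act K V)%N.
Proof.
rewrite /act_dim; case: pickP => [B /card_act_basis // | no_basis].
by have [B] := act_basis_exists; rewrite no_basis.
Qed.

End ActDim.

Lemma dim_ext_dim (F : finFieldType) (L : fieldExtType F) (V : vectType F)
    (A : extension_action L V) :
  \dim {:V} = (\dim {:L} * ext_dim A)%N.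
Proof.
apply/eqP; rewrite -(eqn_exp2l _ _ (finNzRing_gt1 F)) expnM.
rewrite -!card_finvect -!cardsT.
apply/eqP/(@card_act_dim _ _ _ (fun a b : finvect_type L => b * a : L) (1 : L)).
- by move=> u v a; exact: (ext_actDr A a u v).
- by move=> v a b; exact: (ext_actDl A a b v).
- by move=> v a b; exact: esym (ext_actM A b a v).
- by move=> v; exact: (ext_act1 A v).
- by rewrite inE.
- by move=> a b; rewrite !inE.
- by move=> a b; rewrite !inE.
- by move=> a _ nz_a; exists (a : L)^-1; rewrite ?inE // mulVf.
- by rewrite inE.
- by move=> u v; rewrite !inE.
by move=> v a; rewrite !inE.
Qed.

(** * Precomposition and right idealisers *)

Section Precomp.

Variables (F : fieldType) (U V W : vectType F) (g : 'Hom(U, V)).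

Definition precomp_fun (f : 'Hom(V, W)) : 'Hom(U, W) := (f \o g)%VF.

Fact precomp_is_linear : linear precomp_fun.
Proof. by move=> k f1 f2; rewrite /precomp_fun comp_lfunDl comp_lfunZl. Qed.
HB.instance Definition _ :=
  GRing.isSemilinear.Build F 'Hom(V, W) 'Hom(U, W) _ precomp_fun
    (GRing.semilinear_linear precomp_is_linear).

Definition precompv : 'Hom('Hom(V, W), 'Hom(U, W)) := linfun precomp_fun.

Lemma precompvE f : precompv f = (f \o g)%VF.
Proof. by rewrite lfunE. Qed.

End Precomp.

Lemma precompv_inj (F : fieldType) (V W : vectType F) (g : 'End(V)) :
  lker g == 0%VS -> lker (precompv W g) == 0%VS.
Proof.
move=> /lker0_compfK gK; apply/lker0P.
apply: (can_inj (g := precompv W g^-1%VF)) => f.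
by rewrite !precompvE gK.
Qed.

Section RightIdealiser.

Variables (F : finFieldType) (V W : vectType F).
Implicit Type C : {vspace 'Hom(V, W)}.

Lemma mem_code_set C (f : 'Hom(V, W)) :
  ((f : finvect_type _) \in code_set C) = (f \in C).
Proof. by rewrite inE. Qed.

Lemma mem_right_idealiser C (Z : 'End(V)) :
  reflect (forall f, f \in C -> (f \o Z)%VF \in C)
          ((Z : finvect_type _) \in right_idealiser C).
Proof.
rewrite inE; apply: (iffP forallP) => [ZC f Cf | ZC f].
  by have /implyP := ZC f; apply.
by apply/implyP; apply: ZC.
Qed.

Lemma right_idealiser_vspace C :
  exists R : {vspace 'End(V)},
    forall Z : 'End(V), (Z \in R) = (Z \in right_idealiser C).
Proof.
apply: linear_set_vspace => [|c Y Z].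
  by apply/mem_right_idealiser => f _; rewrite comp_lfun0r mem0v.
move=> /mem_right_idealiser CY /mem_right_idealiser CZ.
apply/mem_right_idealiser => f Cf.
by rewrite comp_lfunDr -comp_lfunZr rpredD ?rpredZ ?CY ?CZ.
Qed.

End RightIdealiser.

(** By finiteness of dimension, an injective [f |-> f \o Z] that preserves [C]
is onto [C]. *)
Lemma right_idealiser_inv (F : finFieldType) (V W : vectType F)
    (C : {vspace 'Hom(V, W)}) (Z : 'End(V)) :
  lker Z == 0%VS ->
  (Z : finvect_type _) \in right_idealiser C ->
  ((Z^-1)%VF : finvect_type _) \in right_idealiser C.
Proof.
move=> injZ /mem_right_idealiser CZ; apply/mem_right_idealiser => f Cf.
have imgC : (precompv W Z @: C)%VS = C.
  apply/eqP; rewrite eqEdim limg_dim_eq ?leqnn ?andbT.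
    by apply/subvP => _ /memv_imgP[g Cg ->]; rewrite precompvE CZ.
  by rewrite (eqP (precompv_inj W injZ)) capv0.
move: Cf; rewrite -{1}imgC => /memv_imgP[g Cg ->].
by rewrite precompvE lker0_compfK.
Qed.

Lemma card_right_dim (F : finFieldType) (V W : vectType F)
    (C : {vspace 'Hom(V, W)}) :
  (forall Z, (Z : finvect_type _) \in right_idealiser C -> Z != 0 ->
     lker Z == 0%VS) ->
  #|code_set C| = (#|right_idealiser C| ^ right_dim C)%N.
Proof.
move=> injR; have [R memR] := right_idealiser_vspace C.
pose mul (Y Z : finvect_type 'End(V)) := (Y \o Z)%VF.
apply: (@card_act_dim _ _ _ mul \1%VF).
- by move=> f g Z; apply: comp_lfunDl.
- by move=> f Y Z; apply: comp_lfunDr.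
- by move=> f Y Z; rewrite comp_lfunA.
- by move=> f; apply: comp_lfun1r.
- by apply/mem_right_idealiser => f; rewrite comp_lfun1r.
- by move=> Y Z; rewrite -!memR; apply: rpredB.
- move=> Y Z /mem_right_idealiser CY /mem_right_idealiser CZ.
  by apply/mem_right_idealiser => f Cf; rewrite comp_lfunA CZ ?CY.
- move=> Z RZ nzZ; have injZ := injR Z RZ nzZ; exists (Z^-1)%VF.
    exact: right_idealiser_inv.
  exact: lker0_compfV.
- by rewrite mem_code_set mem0v.
- by move=> f g; rewrite !mem_code_set; apply: rpredD.
- by move=> f Z; rewrite !mem_code_set => Cf /mem_right_idealiser; apply.
Qed.

(** * MRD codes *)

(** On a subspace [K'] of dimension [k] containing [K], restriction is injective
on [C], and [C] has the dimension of [Hom(K', W)]. *)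
Lemma interpolation (F : fieldType) (V W : vectType F)
    (C : {vspace 'Hom(V, W)}) k (K : {vspace V}) (h : 'Hom(V, W)) :
  (forall f, f \in C -> f != 0 -> (\dim (lker f) < k)%N) ->
  \dim C = (k * \dim {:W})%N ->
  (\dim K <= k <= \dim {:V})%N ->
  exists2 f, f \in C & {in K, f =1 h}.
Proof.
move=> Cker dimC /subv_extend[K' sKK' dimK'].
pose rho := precompv W (linfun (@vsval _ _ K')).
have rhoE f (x : subvs_of K') : rho f x = f (vsval x).
  by rewrite precompvE comp_lfunE lfunE.
have rho_inj : (C :&: lker rho = 0)%VS.
  apply/eqP; rewrite -subv0; apply/subvP => f.
  case/memv_capP=> Cf /[!memv_ker] /eqP rf0.
  rewrite memv0; apply: contraT => /(Cker _ Cf); rewrite ltnNge -dimK' dimvS //.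
  apply/subvP => x K'x; rewrite memv_ker -[x]/(vsval (Subvs K'x)) -rhoE rf0.
  by rewrite zero_lfunE.
have : rho h \in (rho @: C)%VS.
  suff /eqP-> : (rho @: C)%VS == fullv by rewrite memvf.
  rewrite eqEdim subvf limg_dim_eq // dimC dim_hom -dimK'.
  by rewrite [\dim {:subvs_of K'}]dimvf /= leqnn.
case/memv_imgP=> f Cf rhf; exists f => // x /(subvP sKK') K'x.
by rewrite -[x]/(vsval (Subvs K'x)) -!rhoE rhf.
Qed.

Section MRD.

Variables (F : finFieldType) (V W : vectType F) (t n iota : nat).
Implicit Type C : {vspace 'Hom(V, W)}.

Lemma MRD_codeP C :
  (n <= t)%N -> MRD_code t n (n - iota) C ->
  [/\ (iota < n)%N, \dim C = (iota.+1 * t)%N,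
      forall f, f \in C -> f != 0 -> (\dim (lker f) < iota.+1)%N
    & exists f, [/\ f \in C, f != 0 & \dim (lker f) = iota]].
Proof.
move=> le_nt [[dimW dimV [[f0 [Cf0 nz_f0 rk_f0]] min_rk]] cardC].
have lt_iota : (iota < n)%N.
  rewrite -subn_gt0 -rk_f0 lt0n dimv_eq0; apply: contra_neq nz_f0 => img0.
  apply/lfunP => x; rewrite zero_lfunE; apply/eqP.
  by rewrite -memv0 -img0 memv_img ?memvf.
split=> //.
- have F_gt1 : (1 < #|F|)%N := finNzRing_gt1 F.
  apply/eqP; rewrite -(eqn_exp2l _ _ F_gt1) -card_finvect_sub.
  rewrite [X in X == _]cardC (maxn_idPl le_nt) (minn_idPr le_nt).
  by rewrite subKn 1?ltnW // addn1 mulnC.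
- move=> f Cf nz_f; have := min_rk f Cf nz_f; have := dim_limg f.
  by rewrite dimV ltnS => <-; rewrite leq_subLR leq_add2r.
exists f0; split=> //; apply/eqP.
by rewrite -(eqn_add2r (n - iota)) -{1}rk_f0 dim_limg dimV subnKC // ltnW.
Qed.

(** The maps of [C] are determined by their restriction to a subspace of
dimension more than [iota], and arbitrary on a subspace of dimension at most
[iota.+1]: either way the image of [Z] gives a contradiction with [lker Z]. *)
Lemma MRD_idealiser_inj C (Z : 'End(V)) :
  (n <= t)%N -> MRD_code t n (n - iota) C ->
  #|right_idealiser C| = (#|F| ^ n)%N ->
  Z \in right_idealiser C -> Z != 0 -> lker Z == 0%VS.
Proof.
move=> le_nt mrdC cardR /mem_right_idealiser CZ nz_Z.
have [lt_iota dimC kerC _] := MRD_codeP le_nt mrdC.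
have n_gt0 : (0 < n)%N := leq_ltn_trans (leq0n _) lt_iota.
have [[dimW dimV _] _] := mrdC; rewrite -dimW in dimC.
have interp K (h : 'Hom(V, W)) :
    (\dim K <= iota.+1)%N -> exists2 f, f \in C & {in K, f =1 h}.
  by move=> leK; apply: interpolation kerC dimC _; rewrite leK dimV.
have [w nz_w] : exists w : W, w != 0.
  exists (vpick {:W}); rewrite vpick0 -dimv_eq0 -lt0n dimW.
  exact: leq_trans n_gt0 le_nt.
have img_gt0 : (0 < \dim (limg Z))%N.
  rewrite lt0n dimv_eq0; apply: contra_neq nz_Z => img0.
  apply/lfunP => x; rewrite zero_lfunE; apply/eqP.
  by rewrite -memv0 -img0 memv_img ?memvf.
apply: contraT => nz_ker.
have ker_gt0 : (0 < \dim (lker Z))%N by rewrite lt0n dimv_eq0.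
have [le_img | le_img] := leqP (\dim (limg Z)) iota.
  have nz_v : vpick (limg Z) != 0 by rewrite vpick0 -dimv_eq0 -lt0n.
  have [h hv h_img] := exists_rank1_hom w nz_v.
  have [f Cf f_h] := interp (limg Z) h (leqW le_img).
  have nz_fZ : (f \o Z)%VF != 0.
    have /memv_imgP[x _ Zx] := memv_pick (limg Z).
    apply: contra_neq nz_w => fZ0.
    by rewrite -hv -f_h ?memv_pick // Zx -comp_lfunE fZ0 zero_lfunE.
  have := kerC _ (CZ f Cf) nz_fZ.
  have : (\dim (limg (f \o Z)%VF) <= 1)%N.
    have : (\dim <[w]> <= 1)%N by rewrite dim_vline leq_b1.
    apply: leq_trans; apply: dimvS.
    apply/subvP => _ /memv_imgP[x _ ->].
    rewrite comp_lfunE f_h ?memv_img ?memvf //.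
    by apply: (subvP h_img); rewrite memv_img ?memvf.
  have := dim_limg (f \o Z)%VF; have := dim_limg Z; rewrite dimV.
  move=> dim1 dim2 img1 ker1.
  (* The composite has rank at most one, so the minimum distance is one. *)
  have dimn : n = iota.+1 by lia.
  have fullC : C = fullv.
    by apply/eqP; rewrite eqEdim subvf dimC dim_hom dimV dimn leqnn.
  have fullR : right_idealiser C = setT.
    apply/setP => Y; rewrite in_setT; apply/mem_right_idealiser => g _.
    by rewrite fullC memvf.
  move: cardR; rewrite fullR cardsT card_finvect dim_hom dimV => /eqP.
  rewrite eqn_exp2l ?finNzRing_gt1 //; move/eqP => n1.
  nia.
(* Now [f |-> f \o Z] permutes [C], although its values vanish on [lker Z]. *)
have imgC : (precompv W Z @: C)%VS = C.
  apply/eqP; rewrite eqEdim; apply/andP; split.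
    by apply/subvP => _ /memv_imgP[f Cf ->]; rewrite precompvE CZ.
  rewrite limg_dim_eq //; apply/eqP; rewrite -subv0; apply/subvP => f.
  rewrite memv_cap memv_ker precompvE memv0 => /andP[Cf /eqP fZ0].
  apply: contraT => /(kerC _ Cf); rewrite ltnNge (leq_trans le_img) // dimvS //.
  apply/subvP => _ /memv_imgP[x _ ->].
  by rewrite memv_ker -comp_lfunE fZ0 zero_lfunE.
have nz_z : vpick (lker Z) != 0 by rewrite vpick0.
have [h hz _] := exists_rank1_hom w nz_z.
have [f Cf f_h] : exists2 f, f \in C & {in <[vpick (lker Z)]>%VS, f =1 h}.
  by apply: interp; rewrite dim_vline nz_z.
move: (Cf); rewrite -imgC => /memv_imgP[f' _]; rewrite precompvE => f_eq.
case/eqP: nz_w; rewrite -hz -f_h ?memv_line // f_eq comp_lfunE.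
by have := memv_pick (lker Z); rewrite memv_ker => /eqP->; rewrite linear0.
Qed.

End MRD.

(** Both sides are the exponent of [#|F|] in the cardinality of [C]. *)
Lemma right_dim_MRD (F : finFieldType) (V W : vectType F)
    (C : {vspace 'Hom(V, W)}) t n iota :
  (n <= t)%N -> MRD_code t n (n - iota) C ->
  #|right_idealiser C| = (#|F| ^ n)%N ->
  (right_dim C * n = t * (iota + 1))%N.
Proof.
move=> le_nt mrdC cardR.
have [_ dimC _ _] := MRD_codeP le_nt mrdC.
have injR Z : (Z : finvect_type _) \in right_idealiser C -> Z != 0 ->
    lker Z == 0%VS.
  exact: MRD_idealiser_inj mrdC cardR.
apply/eqP; rewrite -(eqn_exp2l _ _ (finNzRing_gt1 F)) mulnC expnM -cardR.
by rewrite -card_right_dim // card_finvect_sub dimC mulnC addn1.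
Qed.

(** * Codes composed with a bijection *)

Section Precomposition.

Variables (F : finFieldType) (V W : vectType F).
Variables (C : {vspace 'Hom(V, W)}) (g : 'End(V)).
Hypothesis inj_g : lker g == 0%VS.
Let C' : {vspace 'Hom(V, W)} := (precompv W g @: C)%VS.

Lemma mem_precompv_img f : ((f \o g)%VF \in C') = (f \in C).
Proof.
rewrite -precompvE; apply/idP/idP => [/memv_imgP[f' Cf'] | Cf]; last first.
  exact: memv_img.
by move/(lker0P (precompv_inj W inj_g))->.
Qed.

Lemma precompv_imgP f : f \in C' -> exists2 f', f' \in C & f = (f' \o g)%VF.
Proof. by case/memv_imgP=> f' Cf' ->; exists f' => //; rewrite precompvE. Qed.

Lemma MRD_precompv m n d : MRD_code m n d C -> MRD_code m n d C'.
Proof.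
have rk f : \dim (limg (f \o g)%VF) = \dim (limg f).
  by rewrite limg_comp lker0_limgf.
move=> [[dimW dimV [[f0 [Cf0 nz_f0 rk_f0]] min_rk]] cardC]; split; last first.
  rewrite -cardC !card_finvect_sub limg_dim_eq //.
  by rewrite (eqP (precompv_inj W inj_g)) capv0.
have nz f : (f \o g)%VF != 0 -> f != 0.
  by apply: contra_neq => ->; rewrite comp_lfun0l.
split=> //; split.
  exists (f0 \o g)%VF; rewrite mem_precompv_img rk; split=> //.
  apply: contra_neq nz_f0 => f0g.
  by rewrite -(lker0_compfK inj_g f0) f0g comp_lfun0l.
by move=> _ /precompv_imgP[f Cf ->] /nz nz_f; rewrite rk min_rk.
Qed.

Lemma equivalent_precompv (e1 : (\dim {:V}).-tuple V)
    (e2 : (\dim {:W}).-tuple W) :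
  basis_of {:V} e1 -> basis_of {:W} e2 ->
  equivalent_codes e1 e2 C C'.
Proof.
move=> be1 be2.
exists 1%:M, (passmx.mxof e1 e1 g)^T, 0, idfun; split.
- exact: unitmx1.
- rewrite unitmx_tr; have /mulmx1_unit[] // :
    passmx.mxof e1 e1 g *m passmx.mxof e1 e1 (g^-1)%VF = 1%:M.
  rewrite -(passmx.mxof_comp _ _ be1) lker0_compVf // passmx.mxof1 //.
  exact: basis_free be1.
- by exists idfun.
have mx_comp f : code_mx e1 e2 (f \o g)%VF =
    1%:M *m map_mx idfun (code_mx e1 e2 f) *m (passmx.mxof e1 e1 g)^T + 0.
  rewrite map_mx_id // mul1mx addr0 /code_mx.
  by rewrite (passmx.mxof_comp _ _ be1) trmx_mul.
move=> f; split=> [/precompv_imgP[f' Cf' ->] | [f' Cf']].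
  by exists f'.
rewrite -mx_comp => /trmx_inj/(can_inj (passmx.mxofK be1 be2)) ->.
by rewrite mem_precompv_img.
Qed.

(** The idealiser of [C \o g] is conjugated by [g] into that of [C]. *)
Lemma card_right_idealiser_precompv :
  (#|right_idealiser C'| <= #|right_idealiser C|)%N.
Proof.
pose conj (Z : finvect_type 'End(V)) : finvect_type 'End(V) :=
  ((g \o Z) \o g^-1)%VF.
have conj_inj : injective conj.
  move=> Y Z /(congr1 (fun f : 'End(V) => (g^-1 \o (f \o g))%VF)).
  by rewrite /conj !lker0_compfVK // !lker0_compKf.
rewrite -(card_imset _ conj_inj); apply: subset_leq_card.
apply/subsetP => _ /imsetP[Z /mem_right_idealiser C'Z ->].
apply/mem_right_idealiser => f Cf; rewrite -mem_precompv_img.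
by rewrite /conj comp_lfunA lker0_compfVK // comp_lfunA C'Z // mem_precompv_img.
Qed.

End Precomposition.

Lemma card_mult_maps (F : finFieldType) (L : fieldExtType F) :
  #|mult_maps L| = (#|F| ^ \dim {:L})%N.
Proof. by rewrite card_imset ?card_finvect //; apply: amull_inj. Qed.

(** * Evaluation at one *)

Lemma ext_act0 (F : finFieldType) (L : fieldExtType F) (V : vectType F)
    (A : extension_action L V) a : A a 0 = 0.
Proof. by apply: (addrI (A a 0)); rewrite -ext_actDr !addr0. Qed.

Section EvaluationAtOne.

Variables (F : finFieldType) (L : fieldExtType F) (W : vectType F).
Variables (C : {vspace 'Hom(L, W)}).
Hypothesis hR : right_idealiser C = mult_maps L.

Local Notation A := (code_action hR).

Lemma eval_one_action a f : eval_one C (A a f) = vsval f a.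
Proof. by rewrite eval_oneE comp_lfunE [amull a 1]lfunE /= mulr1. Qed.

(** [a |-> f \o amull a] is injective, and its value at [a] lies in the kernel
of the evaluation at one iff [f a = 0]. *)
Lemma dim_cap_line (f : subvs_of C) : f != 0 ->
  \dim (lker (eval_one C) :&: limg (tau A f)) = \dim (lker (vsval f)).
Proof.
move=> nz_f.
have inj_tau : lker (tau A f) == 0%VS.
  rewrite -subv0; apply/subvP => a; rewrite memv_ker tauE memv0 => /eqP fa0.
  apply: contraNT nz_f => nz_a; apply/eqP.
  rewrite -[f](ext_act1 A) -(mulVf nz_a) ext_actM fa0.
  by rewrite ext_act0.
rewrite -[RHS](limg_dim_eq (f := tau A f)) ?(eqP inj_tau) ?capv0 //.
congr (\dim _); apply/vspaceP => h; apply/idP/idP.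
  move=> /memv_capP[/[!memv_ker] + /mem_limg_tau[a h_a]].
  by rewrite h_a eval_one_action -tauE => fa0; rewrite memv_img // memv_ker.
case/memv_imgP=> a /[!memv_ker] fa0 ->; apply/memv_capP; split; last first.
  by rewrite memv_img ?memvf.
by rewrite tauE memv_ker eval_one_action.
Qed.

Lemma code_set_CUG : code_set C = CUG A (eval_one C).
Proof.
have compE f : (eval_one C \o tau A f)%VF = vsval f.
  by apply/lfunP => a; rewrite comp_lfunE tauE eval_one_action.
apply/setP => f; apply/idP/imsetP => [|[g _ ->]]; rewrite mem_code_set.
  by move=> Cf; exists (Subvs Cf); rewrite ?compE.
by rewrite compE subvsP.
Qed.

Lemma dim_lker_eval_one t n iota :
  (n <= t)%N -> MRD_code t n (n - iota) C ->
  \dim (lker (eval_one C)) = (iota * t)%N.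
Proof.
move=> le_nt mrdC; have [[dimW dimL _] _] := mrdC.
have [lt_iota dimC kerC _] := MRD_codeP le_nt mrdC.
suff surj : limg (eval_one C) = fullv.
  have := dim_limg (eval_one C); rewrite surj dimW dimvf /= => /eqP.
  by rewrite [X in _ == X]dimC mulSn addnC eqn_add2l => /eqP.
apply/eqP; rewrite eqEsubv subvf /=; apply/subvP => w _.
have [h h1 _] := exists_rank1_hom w (oner_neq0 L).
have [f Cf f_h] : exists2 f, f \in C & {in <[1 : L]>%VS, f =1 h}.
  rewrite -dimW in dimC.
  by apply: interpolation kerC dimC _; rewrite dim_vline oner_neq0 dimL.
apply/memv_imgP; exists (Subvs Cf); rewrite ?memvf //.
by rewrite eval_oneE /= f_h ?memv_line.
Qed.

Lemma max_cap_line t n iota :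
  (n <= t)%N -> MRD_code t n (n - iota) C ->
  \max_(f : finvect_type (subvs_of C))
     \dim (lker (eval_one C) :&: limg (tau A f)) = iota.
Proof.
move=> le_nt mrdC; have [[dimW dimL _] _] := mrdC.
have [_ _ kerC [f0 [Cf0 nz_f0 ker_f0]]] := MRD_codeP le_nt mrdC.
have nz_val (f : subvs_of C) : f != 0 -> vsval f != 0.
  by apply: contra_neq => f0'; apply: val_inj.
apply/eqP; rewrite eqn_leq; apply/andP; split.
  apply/bigmax_leqP => f _; have [-> | nz_f] := eqVneq (f : subvs_of C) 0.
    rewrite (_ : limg _ = 0%VS) ?capv0 ?dimv0 //.
    apply/eqP; rewrite -subv0; apply/subvP => _ /mem_limg_tau[a ->].
    by rewrite memv0 ext_act0.
  rewrite (dim_cap_line nz_f).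
  exact: kerC (vsval f) (subvsP f) (nz_val f nz_f).
have := leq_bigmax (F := fun f : finvect_type (subvs_of C) =>
   \dim (lker (eval_one C) :&: limg (tau A f))) (Subvs Cf0).
rewrite dim_cap_line /= ?ker_f0 //.
Qed.

End EvaluationAtOne.

(** * Structure of MRD codes with a maximal right idealiser *)

Theorem theorem3p5
  (q n t iota r : nat)
  (F : finFieldType) (hq : #|F| = q)
  (L : fieldExtType F) (hn : \dim {:L} = n)
  (W : vectType F) (ht : \dim {:W} = t)
  (eL : (\dim {:L}).-tuple L) (heL : basis_of {:L} eL)
  (eW : (\dim {:W}).-tuple W) (heW : basis_of {:W} eW)
  (C : {vspace 'Hom(L, W)})
  (hC : MRD_code t n (n - iota) C)
  (htn : (n <= t)%N)
  (hR : #|right_idealiser C| = (q ^ n)%N)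
  (hr : right_dim C = r) :
  [/\ (iota + 1 %| r * n)%N /\ t = (r * n %/ (iota + 1))%N,
      exists C' : {vspace 'Hom(L, W)},
        [/\ equivalent_codes eL eW C C',
            MRD_code t n (n - iota) C'
          & right_idealiser C' = mult_maps L]
    & forall C' : {vspace 'Hom(L, W)},
        equivalent_codes eL eW C C' ->
        MRD_code t n (n - iota) C' ->
        forall hR' : right_idealiser C' = mult_maps L,
        exists U : {vspace subvs_of C'},
          [/\ forall f : subvs_of C', (f \in U) = (vsval f 1 == 0),
              \dim U = (iota * r * n %/ (iota + 1))%N,
              \max_(f : finvect_type (subvs_of C'))
                 \dim (U :&: limg (tau (code_action hR') f)) = iota,
              CUG_data (code_action hR') r n U (eval_one C')
            & code_set C' = CUG (code_action hR') (eval_one C')]].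
Proof.
subst q; have n_gt0 : (0 < n)%N by rewrite -hn adim_gt0.
have rnE : (r * n = t * (iota + 1))%N by rewrite -hr; apply: right_dim_MRD.
split.
- by rewrite rnE dvdn_mull // mulnK // addn1.
- have [R memR] := right_idealiser_vspace C.
  have [||||g inj_g gR] := @division_subalgebra_conj F L R.
  + by rewrite memR; apply/mem_right_idealiser => f; rewrite comp_lfun1r.
  + move=> Y Z.
    rewrite !memR => /mem_right_idealiser CY /mem_right_idealiser CZ.
    by apply/mem_right_idealiser => f Cf; rewrite comp_lfunA CZ ?CY.
  + by move=> Z; rewrite memR; apply: MRD_idealiser_inj htn hC hR.
  + apply/eqP; rewrite -(eqn_exp2l _ _ (finNzRing_gt1 F)).
    rewrite -card_finvect_sub hn -hR.
    by apply/eqP/eq_card => Z; rewrite inE memR.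
  exists (precompv W g @: C)%VS; split.
  + exact: equivalent_precompv.
  + exact: MRD_precompv.
  (* One inclusion is enough, as the idealisers have the same cardinality. *)
  apply/esym/eqP; rewrite eqEcard card_mult_maps hn -hR.
  rewrite card_right_idealiser_precompv // andbT.
  apply/subsetP => _ /imsetP[a _ ->].
  apply/mem_right_idealiser => _ /precompv_imgP[f Cf ->].
  have [Z RZ gaE] := gR a.
  rewrite -comp_lfunA gaE comp_lfunA mem_precompv_img //.
  by move: RZ; rewrite memR => /mem_right_idealiser; apply.
move=> C' _ mrdC' hR'; exists (lker (eval_one C')).
have dimU := dim_lker_eval_one htn mrdC'.
have [_ dimC' _ _] := MRD_codeP htn mrdC'.
split.
- by move=> f; rewrite memv_ker eval_oneE.
- by rewrite dimU -mulnA rnE mulnA mulnK ?addn1.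
- exact: max_cap_line mrdC'.
- split=> //.
    have dimE : (\dim C' = n * ext_dim (code_action hR'))%N.
      by rewrite -hn -dim_ext_dim dimvf.
    apply/eqP; rewrite -(eqn_pmul2l n_gt0) -dimE dimC' [(n * r)%N]mulnC rnE.
    by rewrite addn1 mulnC.
  by rewrite ht dimU rnE mulnDr muln1 addnC mulnC.
exact: code_set_CUG.
Qed.
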